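(* Let $R>r>0$ and let $\Phi:\mathbb{T}^2\to\mathcal{T}\subset\mathbb{R}^3$ be the standard periodic parametrization of the torus with radii $R,r$. For every $p\in\mathbb{T}^2$, there exist a neighborhood $U\subset\mathbb{T}^2$ of $p$ and constants $c_1,c_2>0$ such that $$c_1\,d_{\mathrm{per}}(p,q)\le d_E(\Phi(p),\Phi(q))\le c_2\,d_{\mathrm{per}}(p,q)\qquad\text{for all } q\in U.$$
   Context: For $R>r>0$, the torus is $\mathcal{T}=\{(x,y,z)\in\mathbb{R}^3:(\sqrt{x^2+y^2}-R)^2+z^2=r^2\}$. The parameter domain is the quotient $\mathbb{T}^2=\mathbb{R}^2/(2\pi\mathbb{Z})^2$. The $2\pi$-periodic (in each variable) map $$\Phi(\theta,\phi)=\bigl((R+r\cos\theta)\cos\phi,\ (R+r\cos\theta)\sin\phi,\ r\sin\theta\bigr)$$ induces a map $\Phi:\mathbb{T}^2\to\mathcal{T}$, denoted by the same symbol. The flat periodic distance on $\mathbb{T}^2$ is $$d_{\mathrm{per}}(p,q)=\min_{k\in(2\pi\mathbb{Z})^2}\|\widetilde p-\widetilde q+k\|_2,$$ where $\widetilde p,\widetilde q\in\mathbb{R}^2$ are any representatives of $p,q$. The ambient Euclidean distance on $\mathcal{T}$ is $d_E(P,Q)=\|P-Q\|_2$. Neighborhoods in $\mathbb{T}^2$ are with respect to the quotient topology. *)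

(* Defs.v *)
From HB Require Import structures.
From mathcomp Require Import all_boot all_order all_algebra generic_quotient.
From mathcomp Require Import zify ring lra.
From mathcomp Require Import all_classical all_reals all_analysis.

Set Implicit Arguments.
Unset Strict Implicit.
Unset Printing Implicit Defensive.

Import Order.TTheory GRing.Theory Num.Theory.
Import numFieldNormedType.Exports.

Local Open Scope classical_set_scope.
Local Open Scope ring_scope.
Local Open Scope quotient_scope.

(* The library norm on ['rV_n] is the sup norm, hence this definition. *)
Definition norm2 (K : realType) (n : nat) (v : 'rV[K]_n) : K :=
  Num.sqrt (\sum_i v 0 i ^+ 2).

Definition lattice (K : realType) : set 'rV[K]_2 :=
  [set (2 * pi) *: map_mx intr k | k in [set: 'rV[int]_2]].

Definition lattice_eq (K : realType) : rel 'rV[K]_2 :=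
  fun x y => `[< lattice (x - y) >].

Section LatticeTheory.
Variable K : realType.
Implicit Types (x y z : 'rV[K]_2).

Lemma lattice0 : lattice (0 : 'rV[K]_2).
Proof. by exists 0 => //; rewrite map_mx0 scaler0. Qed.

Lemma latticeN x : lattice x -> lattice (- x).
Proof. by move=> [k _ <-]; exists (- k) => //; rewrite map_mxN scalerN. Qed.

Lemma latticeD x y : lattice x -> lattice y -> lattice (x + y).
Proof.
move=> [k _ <-] [l _ <-]; exists (k + l) => //.
by rewrite map_mxD scalerDr.
Qed.

Lemma lattice_eq_refl : reflexive (@lattice_eq K).
Proof. by move=> x; apply/asboolP; rewrite subrr; exact: lattice0. Qed.

Lemma lattice_eq_sym : symmetric (@lattice_eq K).
Proof.
by move=> x y; apply/asboolP/asboolP => /latticeN; rewrite opprB.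
Qed.

Lemma lattice_eq_trans : transitive (@lattice_eq K).
Proof.
move=> y x z /asboolP xy /asboolP yz; apply/asboolP.
by have := latticeD xy yz; rewrite addrA subrK.
Qed.

End LatticeTheory.

Canonical lattice_equiv (K : realType) :=
  EquivRel (@lattice_eq K) (@lattice_eq_refl K) (@lattice_eq_sym K)
    (@lattice_eq_trans K).

Definition flat_torus (K : realType) :=
  quotient_topology {eq_quot (lattice_equiv K)}.

(* The infimum is a minimum ([d_per_min]) and does not depend on the
   representatives ([d_perE]). *)
Definition d_per (K : realType) (p q : flat_torus K) : K :=
  inf [set norm2 (repr p - repr q + k) | k in @lattice K].

Definition d_E (K : realType) (P Q : 'rV[K]_3) : K := norm2 (P - Q).

Definition torus (K : realType) (R r : K) : set 'rV[K]_3 :=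
  [set v | (Num.sqrt (v 0 0 ^+ 2 + v 0 1 ^+ 2) - R) ^+ 2 + v 0 2%:R ^+ 2
           = r ^+ 2].

Definition Phi_cover (K : realType) (R r : K) (x : 'rV[K]_2) : 'rV[K]_3 :=
  let theta := x 0 0 in
  let phi := x 0 1 in
  \row_i [:: (R + r * cos theta) * cos phi;
             (R + r * cos theta) * sin phi;
             r * sin theta]`_i.

Definition Phi (K : realType) (R r : K) (p : flat_torus K) : 'rV[K]_3 :=
  Phi_cover R r (repr p).

Section WellDefined.
Variable K : realType.
Implicit Types (x y : 'rV[K]_2) (R r : K).

Lemma flat_torus_eqP x y :
  \pi_(flat_torus K) x = \pi_(flat_torus K) y <-> lattice (x - y).
Proof.
split; first by move=> /(@eqmodP _ (lattice_equiv K)) /asboolP.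
by move=> h; apply/(@eqmodP _ (lattice_equiv K))/asboolP.
Qed.

Lemma lattice_repr x : lattice (repr (\pi_(flat_torus K) x) - x).
Proof. by apply/flat_torus_eqP; rewrite reprK. Qed.

Lemma cos_sin_2piz (t : K) (n : int) :
  cos (t + 2 * pi * n%:~R) = cos t /\ sin (t + 2 * pi * n%:~R) = sin t.
Proof.
have H (s : K) (m : nat) :
  cos (s + 2 * pi * m%:R) = cos s /\ sin (s + 2 * pi * m%:R) = sin s.
  elim: m => [|m [IHc IHs]]; first by rewrite mulr0 addr0.
  have -> : s + 2 * pi * m.+1%:R = s + 2 * pi * m%:R + pi *+ 2.
    by rewrite -natr1; ring.
  by rewrite cosD2pi sinD2pi.
case: n => m; first exact: H.
have [hc hs] := H (t + 2 * pi * (Negz m)%:~R) m.+1.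
have E : t + 2 * pi * (Negz m)%:~R + 2 * pi * m.+1%:R = t.
  by rewrite NegzE rmorphN /= -pmulrn; ring.
by rewrite -hc -hs E.
Qed.

Lemma Phi_cover_periodic R r x y :
  lattice (x - y) -> Phi_cover R r x = Phi_cover R r y.
Proof.
move=> [k _ E].
have xE i : x 0 i = y 0 i + 2 * pi * (k 0 i)%:~R.
  by have /(congr1 (fun v : 'rV[K]_2 => v 0 i)) := E; rewrite !mxE => ->; ring.
rewrite /Phi_cover !xE.
have [-> ->] := cos_sin_2piz (y 0 0) (k 0 0).
by have [-> ->] := cos_sin_2piz (y 0 1) (k 0 1).
Qed.

Lemma PhiE R r x : Phi R r (\pi_(flat_torus K) x) = Phi_cover R r x.
Proof. exact/Phi_cover_periodic/lattice_repr. Qed.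

Lemma Phi_torus R r (p : flat_torus K) : 0 < r -> r < R -> torus R r (Phi R r p).
Proof.
move=> r0 rR; rewrite /torus /Phi /Phi_cover /= !mxE /=.
set t := repr p 0 0; set f := repr p 0 1.
have h : 0 <= R + r * cos t by have := cos_geN1 t; nra.
have -> : ((R + r * cos t) * cos f) ^+ 2 + ((R + r * cos t) * sin f) ^+ 2
          = (R + r * cos t) ^+ 2.
  by rewrite !exprMn -mulrDr cos2Dsin2 mulr1.
rewrite sqrtr_sqr ger0_norm //.
have -> : R + r * cos t - R = r * cos t by ring.
by rewrite !exprMn -mulrDr cos2Dsin2 mulr1.
Qed.

Lemma d_perE x y :
  d_per (\pi_(flat_torus K) x) (\pi_(flat_torus K) y) =
  inf [set norm2 (x - y + k) | k in @lattice K].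
Proof.
rewrite /d_per.
have hx := lattice_repr x; have hy := lattice_repr y.
set x' := repr _ in hx *; set y' := repr _ in hy *.
congr inf; apply/seteqP; split => _ [k hk <-].
  exists ((x' - x) - (y' - y) + k).
    by apply: latticeD => //; apply: latticeD => //; exact: latticeN.
  by congr norm2; apply/rowP => i; rewrite !mxE; ring.
exists (- (x' - x) + (y' - y) + k).
  by apply: latticeD => //; apply: latticeD => //; exact: latticeN.
by congr norm2; apply/rowP => i; rewrite !mxE; ring.
Qed.

Lemma nearest_2piz (t : K) : exists n : int, forall m : int,
  (t + 2 * pi * n%:~R) ^+ 2 <= (t + 2 * pi * m%:~R) ^+ 2.
Proof.
have p0 := pi_gt0 K.
pose l := Num.floor ((t + pi) / (2 * pi)).
exists (- l) => m; rewrite rmorphN /=.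
have /andP[] := real_floor_itv (num_real ((t + pi) / (2 * pi))).
rewrite -/l ler_pdivlMr ?mulr_gt0 // ltr_pdivrMr ?mulr_gt0 // intrD => h1 h2.
set L := l%:~R : K in h1 h2 *.
have -> : (t + 2 * pi * m%:~R) = (t - 2 * pi * L) + 2 * pi * (m + l)%:~R.
  by rewrite intrD -/L; ring.
have [h|h|->] := ltgtP (m + l) 0.
- have : (m + l)%:~R <= -1 :> K by rewrite -[-1]/((-1)%:~R) ler_int; lia.
  set M := _%:~R => hM.
  have a : t - 2 * pi * L + pi * M <= 0 by nra.
  have b : pi * M <= 0 by nra.
  by have := mulr_le0 b a; nra.
- have : 1 <= (m + l)%:~R :> K by rewrite -[1]/(1%:~R) ler_int; lia.
  set M := _%:~R => hM.
  have a : 0 <= t - 2 * pi * L + pi * M by nra.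
  have b : 0 <= pi * M by nra.
  by have := mulr_ge0 b a; nra.
- by rewrite mulr0 addr0 mulrN.
Qed.

Lemma d_per_min x y : exists2 k, lattice k &
  d_per (\pi_(flat_torus K) x) (\pi_(flat_torus K) y) = norm2 (x - y + k) /\
  forall l, lattice l -> norm2 (x - y + k) <= norm2 (x - y + l).
Proof.
have /choice[n hn] := fun i : 'I_2 => nearest_2piz ((x - y) 0 i).
pose k : 'rV[K]_2 := (2 * pi) *: map_mx intr (\row_i n i).
have kL : lattice k by exists (\row_i n i).
have kmin l : lattice l -> norm2 (x - y + k) <= norm2 (x - y + l).
  move=> [m _ <-]; rewrite /norm2; apply: ler_wsqrtr; apply: ler_sum => i _.
  by have := hn i (m 0 i); rewrite !mxE.
exists k => //; split => //.
rewrite d_perE; apply/eqP; rewrite eq_le; apply/andP; split.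
  apply: ge_inf; last by exists k.
  by exists 0 => _ [l _ <-]; exact: sqrtr_ge0.
by apply: lb_le_inf; [exists (norm2 (x - y + k)), k|move=> _ [l /kmin h <-]].
Qed.

End WellDefined.

(* Main.v *)
(** The chord between two points of the torus satisfies
    [|Phi x - Phi y|^2 = 2 r^2 (1 - cos a) + 2 A B (1 - cos b)], where [a] and
    [b] are the differences of the angles and [A = R + r cos theta],
    [B = R + r cos theta'] lie in [[R - r, R + r]]. Representatives at minimal
    distance have [|a|, |b| <= pi], where [1 - cos] is comparable to the square;
    hence the estimate even holds on the whole torus. *)
Require Import Defs.
From mathcomp Require Import all_boot all_order all_algebra.
From mathcomp Require Import ring lra.
From mathcomp Require Import all_classical all_reals all_analysis.
Import Order.TTheory GRing.Theory Num.Theory.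
Import numFieldNormedType.Exports.
Local Open Scope classical_set_scope.
Local Open Scope ring_scope.

Lemma sin_mvt {K : realType} {x : K} : 0 <= x ->
  exists2 c, 0 <= c <= x & sin x = cos c * x.
Proof.
move=> x0.
have [|c] := @MVT_segment K sin cos 0 x x0 (fun y _ => is_derive_sin y).
  by apply: continuous_subspaceT => y; exact: continuous_sin.
by rewrite in_itv /= sin0 !subr0 => cx ->; exists c.
Qed.

(** Both sides are even, so [0 <= x] may be assumed; then [sin x = cos c * x] with
    [cos c ^+ 2 <= 1]. *)
Lemma ler_sqr_sin {K : realType} (x : K) : sin x ^+ 2 <= x ^+ 2.
Proof.
wlog x0 : x / 0 <= x.
  move=> h; have [/h//|/ltW x0] := leP 0 x.
  by rewrite -sqrrN -[leRHS]sqrrN -sinN; apply: h; rewrite oppr_ge0.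
have [c _ ->] := sin_mvt x0.
rewrite exprMn ler_piMl ?sqr_ge0 // -(cos2Dsin2 c) lerDl; exact: sqr_ge0.
Qed.

(* [sin x = 2 sin (x/2) cos (x/2)], where [sin (x/2) >= (x/2) cos (x/2)] by the
   mean value theorem, and [2 cos (x/2)^2 = 1 + cos x >= 1]. *)
Lemma ler_half_sin {K : realType} {x : K} : 0 <= x <= pi / 2 -> x / 2 <= sin x.
Proof.
move=> /andP[x0 xpi].
have p0 := pi_gt0 K.
have [|c /andP[c0 cx] sE] := @sin_mvt _ (x / 2); first by lra.
have xE : x = (x / 2) *+ 2 by rewrite mulr2n; lra.
have cosx : 0 <= cos x by apply: cos_ge0_pihalf; lra.
have cosh : 0 <= cos (x / 2) by apply: cos_ge0_pihalf; lra.
have cosc : cos (x / 2) <= cos c.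
  move: cx; rewrite le_eqVlt => /predU1P[->//|cx].
  by apply/ltW; rewrite ltr_cos // in_itv /=; lra.
have cosE := cos_mulr2n (x / 2).
have sinE := sin_mulr2n (x / 2).
rewrite -xE in cosE sinE.
rewrite sinE sE.
have h : cos (x / 2) ^+ 2 <= cos (x / 2) * cos c.
  by rewrite expr2; exact: ler_wpM2l.
by rewrite mulrA; nra.
Qed.

Lemma one_sub_cosE {K : realType} (x : K) : 1 - cos x = 2 * sin (x / 2) ^+ 2.
Proof.
have {1}-> : x = (x / 2) *+ 2 by rewrite mulr2n; lra.
by rewrite cos_mulr2n cos2sin2; ring.
Qed.

Lemma one_sub_cos_le {K : realType} (x : K) : 1 - cos x <= x ^+ 2 / 2.
Proof. by rewrite one_sub_cosE; have := ler_sqr_sin (x / 2); nra. Qed.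

(** The half angle lies in [[0, pi / 2]] once [0 <= x], so [sin (x / 2) >= x / 4]; the constant is
    [2 * (1 / 4) ^+ 2 = 1 / 8]. *)
Lemma one_sub_cos_ge {K : realType} {x : K} :
  `|x| <= pi -> x ^+ 2 / 8 <= 1 - cos x.
Proof.
wlog x0 : x / 0 <= x.
  move=> h; have [/h//|/ltW x0] := leP 0 x.
  by rewrite -sqrrN -normrN -cosN; apply: h; rewrite oppr_ge0.
rewrite ger0_norm // => xpi; rewrite one_sub_cosE.
have /ler_half_sin : 0 <= x / 2 <= pi / 2 by lra.
by nra.
Qed.

Lemma sqr_norm2 {K : realType} {n} (v : 'rV[K]_n) :
  norm2 v ^+ 2 = \sum_i v 0 i ^+ 2.
Proof. by rewrite sqr_sqrtr // sumr_ge0 // => i _; exact: sqr_ge0. Qed.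

Lemma norm2_ge0 {K : realType} {n} (v : 'rV[K]_n) : 0 <= norm2 v.
Proof. exact: sqrtr_ge0. Qed.

(** Translating by [2 * pi] or [- 2 * pi] along the single coordinate [i] leaves the other one
    unchanged, so minimality reduces to [u_i ^+ 2 <= (u_i + 2 * pi * s) ^+ 2] for [s = 1] and
    [s = -1]. *)
Lemma lattice_minimal_le_pi {K : realType} {u : 'rV[K]_2} :
  (forall l, lattice l -> norm2 u <= norm2 (u + l)) ->
  forall i, `|u 0 i| <= pi.
Proof.
move=> umin i; have p0 := pi_gt0 K.
have step (s : int) : u 0 i ^+ 2 <= (u 0 i + 2 * pi * s%:~R) ^+ 2.
  have /umin : lattice ((2 * pi) *: map_mx intr (s *: delta_mx 0 i) : 'rV[K]_2).
    by eexists.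
  rewrite -ler_sqr ?nnegrE ?norm2_ge0 // !sqr_norm2.
  rewrite (bigD1 i) //= [in leRHS](bigD1 i) //= !mxE !eqxx /= mulr1.
  rewrite [X in _ <= _ + X](eq_bigr (fun j => u 0 j ^+ 2)) ?lerD2r //.
  move=> j /negbTE ji.
  by rewrite !mxE ji andbF mulr0 mulr0z mulr0 addr0.
have := step 1; have := step (-1); rewrite !intrN !mulr1z ler_norml => h1 h2.
by apply/andP; split; nra.
Qed.

Lemma sqr_chord {K : realType} (R r : K) (x y : 'rV[K]_2) :
  d_E (Phi_cover R r x) (Phi_cover R r y) ^+ 2 =
  2 * r ^+ 2 * (1 - cos ((x - y) 0 0)) +
  2 * ((R + r * cos (x 0 0)) * (R + r * cos (y 0 0))) *
    (1 - cos ((x - y) 0 1)).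
Proof.
rewrite sqr_norm2 !big_ord_recl big_ord0 /Phi_cover !mxE /= !cosB.
have sE t : sin t ^+ 2 = 1 - cos t ^+ 2 :> K by exact: sin2cos2.
by ring: (sE (x 0 0)) (sE (y 0 0)) (sE (x 0 1)) (sE (y 0 1)).
Qed.

Theorem proposition2 (K : realType) (R r : K) (hr : 0 < r) (hR : r < R)
    (p : flat_torus K) :
  exists (U : set (flat_torus K)) (c1 c2 : K),
    [/\ nbhs p U, 0 < c1, 0 < c2 &
      forall q : flat_torus K, U q ->
        c1 * d_per p q <= d_E (Phi R r p) (Phi R r q) /\
        d_E (Phi R r p) (Phi R r q) <= c2 * d_per p q].
Proof.
(* [m] bounds from below both [r] and the distances [A], [B] to the axis. The factor 2 in the
   squared chord gives [2 * m ^+ 2 / 8 = (m / 2) ^+ 2] below and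
   [2 * (R + r) ^+ 2 / 2 = (R + r) ^+ 2] above. *)
pose m := Num.min r (R - r).
have m0 : 0 < m by rewrite lt_min hr subr_gt0.
have mr : m <= r by rewrite ge_min lexx.
have mRr : m <= R - r by rewrite ge_min lexx orbT.
exists setT, (m / 2), (R + r); split; [exact: filterT|lra|lra|move=> q _].
rewrite -[p]reprK -[q]reprK !PhiE.
set x := repr p; set y := repr q.
have [k kL [-> kmin]] := d_per_min x y.
(* Moving [x] by the optimal [k] keeps its image and turns [d_per] into the plain norm of a
   difference of representatives. *)
have -> : Phi_cover R r x = Phi_cover R r (x + k).
  by apply: Phi_cover_periodic; rewrite opprD addrA subrr sub0r; exact: latticeN.
have uE : x - y + k = x + k - y by rewrite addrAC.
have umin l : lattice l -> norm2 (x + k - y) <= norm2 (x + k - y + l).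
  by move=> hl; rewrite -uE -(addrA _ k); apply: kmin; exact: latticeD.
rewrite uE; move: (x + k) umin => z /lattice_minimal_le_pi upi.
have d0 : 0 <= d_E (Phi_cover R r z) (Phi_cover R r y) by exact: norm2_ge0.
have n0 := norm2_ge0 (z - y).
have c10 : 0 <= m / 2 * norm2 (z - y) by apply: mulr_ge0 => //; lra.
have c20 : 0 <= (R + r) * norm2 (z - y) by apply: mulr_ge0 => //; lra.
rewrite -[_ <= d_E _ _]ler_sqr // -[d_E _ _ <= _]ler_sqr //.
rewrite !exprMn sqr_chord sqr_norm2 !big_ord_recl big_ord0 addr0.
have /one_sub_cos_ge := upi 0; have /one_sub_cos_ge := upi 1.
have := one_sub_cos_le ((z - y) 0 0); have := one_sub_cos_le ((z - y) 0 1).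
have -> : lift ord0 ord0 = 1 :> 'I_2 by exact/val_inj.
set a := (z - y) 0 0; set b := (z - y) 0 1.
set ca := 1 - cos a; set cb := 1 - cos b => cb2 ca2 cb1 ca1.
set A := R + r * cos (z 0 0); set B := R + r * cos (y 0 0).
have bnd t : R - r <= R + r * cos t <= R + r.
  by have := cos_geN1 t; have := cos_le1 t; nra.
have /andP[A1 A2] : R - r <= A <= R + r by exact: bnd.
have /andP[B1 B2] : R - r <= B <= R + r by exact: bnd.
have AB1 : m ^+ 2 <= A * B by rewrite expr2; apply: ler_pM; lra.
have AB2 : A * B <= (R + r) ^+ 2 by rewrite expr2; apply: ler_pM; lra.
have r1 : m ^+ 2 <= r ^+ 2 by rewrite ler_sqr ?nnegrE; lra.
have r2 : r ^+ 2 <= (R + r) ^+ 2 by rewrite ler_sqr ?nnegrE; lra.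
have a0 := sqr_ge0 a; have b0 := sqr_ge0 b; have mm := sqr_ge0 m.
(* Each bound is proved separately for the [a] and [b] terms of the squared chord, then summed. *)
split.
  have : m ^+ 2 * (a ^+ 2 / 8) <= r ^+ 2 * ca by apply: ler_pM => //; lra.
  have : m ^+ 2 * (b ^+ 2 / 8) <= A * B * cb by apply: ler_pM => //; lra.
  by lra.
have : r ^+ 2 * ca <= (R + r) ^+ 2 * (a ^+ 2 / 2) by apply: ler_pM => //; lra.
have : A * B * cb <= (R + r) ^+ 2 * (b ^+ 2 / 2) by apply: ler_pM => //; lra.
by lra.
Qed.
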